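(* Let $A$ be a totally ordered abelian group and let $P=\{x\in A\mid x\geq 0\}$ be the monoid of its positive elements. Then $P$ fulfills the following property: for all $x,y,u,v\in P$ with $x+y=u+v$, there exists $z\in P$ such that either ($x+z=u$ and $z+v=y$) or ($x=u+z$ and $v=z+y$). Moreover, the symmetrization $s(P)$ is the group $A$, i.e. $s(P)$ with its hypersum is a group (all sums are singletons) and it is isomorphic to $A$.
   Context: Symmetrization: for a commutative monoid $B$ written additively, $s(B)$ is the quotient of $B\times\{-1,1\}$ by the equivalence relation which identifies $(a,1)\sim(b,-1)$ whenever $a+b=0$ in $B$ (classes are written by representatives). Its hypersum is the commutative operation, with values in subsets of $s(B)$, given by $(a,1)+(b,1)=\{(a+b,1)\}$, $(a,-1)+(b,-1)=\{(a+b,-1)\}$, $(a,1)+(b,-1)=\{(z,1): z\in B,\ z+b=a\}\cup\{(z,-1): z\in B,\ z+a=b\}$; this is compatible with the equivalence relation. Its neutral element is the class $(0,1)=(0,-1)$. When all sums are singletons, the hypersum is regarded as an ordinary binary operation on $s(B)$. *)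

(* Defs.v *)
From HB Require Import structures.
From mathcomp Require Import all_boot all_order all_algebra.
From mathcomp Require Import classical_sets.

Set Implicit Arguments.
Unset Strict Implicit.
Unset Printing Implicit Defensive.

Import Order.TTheory GRing.Theory Num.Theory.

Local Open Scope classical_set_scope.
Local Open Scope quotient_scope.
Local Open Scope ring_scope.

(* Totality is an axiom of the mixin, rather than inherited from [Order.Total]:
   Hierarchy Builder refuses a join of [Order.Total] and [GRing.Zmodule] declared
   after [Num.RealDomain]. *)
HB.mixin Record POrderedZmodule_isOrdered A of Num.POrderedZmodule A := {
  oz_total : total (<=%R : rel A);
  oz_leD : forall z x y : A, x <= y -> z + x <= z + y
}.

#[short(type="orderedZmodType")]
HB.structure Definition OrderedZmodule :=
  { A of Num.POrderedZmodule A & POrderedZmodule_isOrdered A }.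

Section PositiveCone.
Variable A : orderedZmodType.

Record posCone := PosCone { posval :> A; _ : 0 <= posval }.
HB.instance Definition _ := [isSub for posval].
HB.instance Definition _ := [Choice of posCone by <:].

Fact posCone_closed : GRing.nmod_closed (fun x : A => 0 <= x).
Proof.
split=> [|x y]; rewrite !unfold_in //= => x0 y0.
by rewrite (le_trans x0) // -[leLHS]addr0 oz_leD.
Qed.
HB.instance Definition _ :=
  GRing.SubChoice_isSubNmodule.Build A _ posCone posCone_closed.

End PositiveCone.

Section Symmetrization.
Variable B : nmodType.

(* A sign is a boolean b, read as (-1) ^+ b: (a, false) stands for (a, 1) and
   (a, true) for (a, -1). *)
Definition symm_rel (p q : B * bool) : bool :=
  if p.2 == q.2 then p.1 == q.1 else p.1 + q.1 == 0.

Fact symm_rel_equiv : equiv_class_of symm_rel.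
Proof.
split=> [[a s]|[a s] [b t]|[b t] [a s] [c u]]; rewrite /symm_rel /=.
- by rewrite !eqxx.
- by rewrite [t == s]eq_sym [b == a]eq_sym [b + a]addrC.
have oppU (x y z : B) : x + y = 0 -> y + z = 0 -> x = z.
  by move=> xy yz; rewrite -[x]addr0 -yz addrA xy add0r.
case: s t u => [] [] [] /= /eqP H1 /eqP H2; apply/eqP; try congruence.
- exact: oppU H1 H2.
- exact: oppU H1 H2.
Qed.
Canonical symm_equiv := EquivRelPack symm_rel_equiv.

Definition symm := {eq_quot symm_equiv}.

Definition spos (a : B) : symm := \pi_symm (a, false).
Definition sneg (a : B) : symm := \pi_symm (a, true).

Definition hsum_mixed (a b : B) : set symm :=
  [set spos z | z in [set z | z + b = a]]
  `|` [set sneg z | z in [set z | z + a = b]].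

Definition hsum_rep (p q : B * bool) : set symm :=
  match p, q with
  | (a, false), (b, false) => [set spos (a + b)]
  | (a, true), (b, true) => [set sneg (a + b)]
  | (a, false), (b, true) => hsum_mixed a b
  | (a, true), (b, false) => hsum_mixed b a
  end.

(* The choice of representatives is immaterial, see [hypersum_pi]. *)
Definition hypersum (x y : symm) : set symm := hsum_rep (repr x) (repr y).

Lemma sposE (a b : B) : a + b = 0 -> spos a = sneg b.
Proof. by move=> ab0; apply/eqmodP; rewrite /= /symm_rel /= ab0. Qed.

Lemma spos0 : spos 0 = sneg 0.
Proof. by apply: sposE; rewrite addr0. Qed.

Lemma hsum_repC p q : hsum_rep p q = hsum_rep q p.
Proof. by case: p q => [a []] [b []] //=; rewrite addrC. Qed.

Lemma hsum_mixed_unit (a b c : B) : a + b = 0 ->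
  hsum_mixed c b = [set spos (a + c)].
Proof.
move=> ab; apply/seteqP; split=> [w [] [z /= zE <-]|w ->].
- by rewrite -zE addrCA ab addr0.
- by apply/esym/sposE; rewrite -addrA [c + z]addrC zE.
- by left; exists (a + c) => //=; rewrite addrAC ab add0r.
Qed.

Lemma hsum_mixed_unitN (a b c : B) : a + b = 0 ->
  hsum_mixed a c = [set sneg (b + c)].
Proof.
move=> ab; apply/seteqP; split=> [w [] [z /= zE <-]|w ->].
- by apply: sposE; rewrite addrCA zE addrC.
- by rewrite -zE addrCA [b + a]addrC ab addr0.
- by right; exists (b + c) => //=; rewrite addrAC [b + a]addrC ab add0r.
Qed.

Lemma hsum_rep_compatl p p' q : symm_rel p p' -> hsum_rep p q = hsum_rep p' q.
Proof.
case: p p' q => [a s] [a' s'] [c u]; rewrite /symm_rel /=.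
case: s s' => [] [] /= /eqP H; rewrite ?H //.
- by case: u => /=; [rewrite (@hsum_mixed_unitN a' a) // addrC
                    |rewrite (@hsum_mixed_unit a' a) // addrC].
- by case: u => /=; [rewrite (@hsum_mixed_unitN a a')
                    |rewrite (@hsum_mixed_unit a a')].
Qed.

Lemma hypersum_pi p q :
  hypersum (\pi_symm p) (\pi_symm q) = hsum_rep p q.
Proof.
have rep r : symm_rel (repr (\pi_symm r)) r.
  by have /eqmodP := reprK (\pi_symm r).
rewrite /hypersum (hsum_rep_compatl _ (rep p)) hsum_repC.
by rewrite (hsum_rep_compatl _ (rep q)) hsum_repC.
Qed.

End Symmetrization.

(* Main.v *)
(* The value of the class of (a, +-1) is +-a; this is a bijection onto A because
   the order is total, and in both mixed and unmixed cases a class w belongs to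
   the hypersum of x and y if and only if its value is the sum of those of x
   and y. Hence the hypersum is single-valued and is the addition of A. *)
Require Import Defs.
From mathcomp Require Import all_boot all_order all_algebra.
From mathcomp Require Import classical_sets.

Import GRing.Theory.

Local Open Scope classical_set_scope.
Local Open Scope quotient_scope.
Local Open Scope ring_scope.

Section SymmetrizedPositiveCone.
Variable A : orderedZmodType.
Implicit Types (a b c : posCone A) (p q : posCone A * bool).
Implicit Types (x y w : symm (posCone A)).

Lemma posval_inj : injective (@posval A).
Proof. exact: val_inj. Qed.

Lemma posvalD : {morph @posval A : a b / a + b}.
Proof. by []. Qed.

Lemma oz_subr_ge0 (x y : A) : (0 <= y - x) = (x <= y).
Proof.
apply/idP/idP => [/(oz_leD x)|/(oz_leD (- x))].
  by rewrite addr0 addrC subrK.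
by rewrite addNr addrC.
Qed.

(** The difference [b - a] taken in [A] is nonnegative, so it is itself an element of the cone. *)
Lemma posCone_subtract a b : (a <= b :> A) -> exists c, a + c = b.
Proof.
rewrite -oz_subr_ge0 => ab; exists (PosCone ab).
by apply: posval_inj; rewrite posvalD /= addrC subrK.
Qed.

(** By totality [x] and [u] are comparable, and [z] is the larger minus the smaller; the remaining
    equation follows from [xyuv] by cancelling the smaller one. *)
Lemma posCone_refinement (x y u v : posCone A) : x + y = u + v ->
  exists z : posCone A, (x + z = u /\ z + v = y) \/ (x = u + z /\ v = z + y).
Proof.
move=> xyuv; have addI a : injective (+%R a).
  move=> b c /(congr1 (@posval A)); rewrite !posvalD.
  by move/addrI/posval_inj.
have /orP[/posCone_subtract[z xz]|/posCone_subtract[z uz]] :=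
  oz_total (posval x) (posval u).
- by exists z; left; split=> //; apply: (addI x); rewrite addrA xz.
- by exists z; right; split=> //; apply: (addI u); rewrite addrA uz.
Qed.

Definition signed_val p : A := if p.2 then - posval p.1 else posval p.1.

(** For opposite signs, [a + b = 0] says exactly that [a = - b] in [A]. One direction makes the
    value well defined on classes, the other makes it injective there. *)
Lemma signed_val_eq p q : (signed_val p == signed_val q) = symm_rel p q.
Proof.
case: p q => [a s] [b t]; rewrite /signed_val /symm_rel /=.
rewrite -!(inj_eq posval_inj) posvalD addr_eq0.
case: s t => [] [] //=; first exact: eqr_opp.
by rewrite eqr_oppLR.
Qed.

Definition symm_val x : A := signed_val (repr x).

Lemma symm_val_pi p : symm_val (\pi_(symm (posCone A)) p) = signed_val p.
Proof.
apply/eqP; rewrite signed_val_eq.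
by have /eqmodP := reprK (\pi_(symm (posCone A)) p).
Qed.

Lemma symm_val_spos a : symm_val (spos a) = posval a.
Proof. exact: symm_val_pi. Qed.

Lemma symm_val_sneg a : symm_val (sneg a) = - posval a.
Proof. exact: symm_val_pi. Qed.

Lemma symm_val_inj : injective symm_val.
Proof.
move=> x y /eqP; rewrite signed_val_eq => xy.
by rewrite -[x]reprK -[y]reprK; apply/eqmodP.
Qed.

(** Stated as a sigma type so that the inverse map can be projected out of it. *)
Lemma symm_val_surj (r : A) : {x | symm_val x = r}.
Proof.
case: (boolP (0 <= r)) => [r0|nr0].
  by exists (spos (PosCone r0)); rewrite symm_val_spos.
(* Totality turns the failure of [0 <= r] into [r <= 0]. *)
have r0 : 0 <= - r.
  by rewrite -sub0r oz_subr_ge0; move: (oz_total 0 r); rewrite (negbTE nr0).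
by exists (sneg (PosCone r0)); rewrite symm_val_sneg /= opprK.
Qed.

Definition symm_of_val (r : A) := sval (symm_val_surj r).

Lemma symm_of_valK : cancel symm_of_val symm_val.
Proof. by move=> r; exact: (svalP (symm_val_surj r)). Qed.

Lemma symm_valK : cancel symm_val symm_of_val.
Proof. by move=> x; apply: symm_val_inj; rewrite symm_of_valK. Qed.

Lemma hsum_mixedP a b w :
  hsum_mixed a b w <-> symm_val w = posval a - posval b.
Proof.
split=> [[] [z /= <- <-]|].
- by rewrite symm_val_spos posvalD addrK.
- by rewrite symm_val_sneg posvalD opprD addrCA subrr addr0.
(* The sign of the representative of [w] selects the part of the union, and its first component [z]
   is the witness. *)
rewrite -[w]reprK symm_val_pi /signed_val; case: (repr w) => z [] /= wE.
- right; exists z => //=; apply: posval_inj; rewrite posvalD.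
  by rewrite -[posval z]opprK wE opprB subrK.
- by left; exists z => //=; apply: posval_inj; rewrite posvalD wE subrK.
Qed.

Lemma hypersumP x y w :
  hypersum x y w <-> symm_val w = symm_val x + symm_val y.
Proof.
rewrite -[x]reprK -[y]reprK hypersum_pi !symm_val_pi.
case: (repr x) (repr y) => a [] [b []]; rewrite /signed_val /=.
- rewrite -opprD -posvalD -symm_val_sneg.
  by split=> [->|/symm_val_inj].
- by rewrite addrC; apply: hsum_mixedP.
- exact: hsum_mixedP.
- rewrite -posvalD -symm_val_spos.
  by split=> [->|/symm_val_inj].
Qed.

End SymmetrizedPositiveCone.

Theorem proposition6p1 (A : orderedZmodType) :
  (forall x y u v : posCone A, x + y = u + v ->
     exists z : posCone A,
       (x + z = u /\ z + v = y) \/ (x = u + z /\ v = z + y)) /\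
  (exists op : symm (posCone A) -> symm (posCone A) -> symm (posCone A),
     (forall x y : symm (posCone A), hypersum x y = [set op x y]) /\
     (exists inv : symm (posCone A) -> symm (posCone A),
        [/\ associative op, commutative op,
            left_id (spos (0 : posCone A)) op
          & left_inverse (spos (0 : posCone A)) inv op]) /\
     (exists f : symm (posCone A) -> A,
        bijective f /\ {morph f : x y / op x y >-> x + y})).
Proof.
split; first exact: posCone_refinement.
(* The operation is the addition of [A] transported along the bijection [symm_val]. *)
exists (fun x y => symm_of_val A (symm_val A x + symm_val A y)); split.
  move=> x y; apply/seteqP; split=> w.
    by move/hypersumP => /= <-; rewrite symm_valK.
  by move=> /= ->; apply/hypersumP; rewrite symm_of_valK.
split; last first.
  exists (symm_val A); split; last by move=> x y; rewrite symm_of_valK.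
  by exists (symm_of_val A); [apply: symm_valK | apply: symm_of_valK].
exists (fun x => symm_of_val A (- symm_val A x)).
(* Injectivity of [symm_val] reduces each group law to the same law in [A]. *)
split=> [x y z|x y|x|x]; apply: symm_val_inj;
  rewrite !symm_of_valK ?symm_val_spos /=.
- exact: addrA.
- exact: addrC.
- exact: add0r.
- exact: addNr.
Qed.
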